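(* Up to isomorphism, the only locally equienergetic graphs of order $4$ are $K_4$ and $K_2\cup K_2$. That is, $e(K_4)=e(K_2\cup K_2)$, and if $G,H$ are non-isomorphic finite simple undirected graphs on $4$ vertices with $e(G)=e(H)$, then $\{G,H\}=\{K_4,\,K_2\cup K_2\}$ up to isomorphism.
   Context: For a finite simple undirected graph $G$ with vertices $v_1,\dots,v_n$, the adjacency matrix $A(G)$ has $(i,j)$ entry $1$ if $v_i,v_j$ are adjacent and $0$ otherwise. The energy $\mathscr{E}(G)$ is the sum of the absolute values of the eigenvalues of $A(G)$ (counted with multiplicity); the graph with no vertices has energy $0$. For a vertex $v$ of $G$, let $G^{v}$ be the graph obtained from $G$ by deleting $v$. The local energy of $G$ at $v$ is $\mathscr{E}_G(v)=\mathscr{E}(G)-\mathscr{E}(G^{v})$, and the local energy of $G$ is $e(G)=\sum_{v\in V(G)}\mathscr{E}_G(v)$. Two (non-isomorphic) graphs $G,H$ of the same order are locally equienergetic if $e(G)=e(H)$. Graphs may be disconnected; $K_m$ is the complete graph on $m$ vertices and $\cup$ is disjoint union. *)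

(* Defs.v *)
From HB Require Import structures.
From mathcomp Require Import all_boot all_order all_algebra.
From mathcomp Require Import polyrcf.

Set Implicit Arguments.
Unset Strict Implicit.
Unset Printing Implicit Defensive.

Import Order.TTheory GRing.Theory Num.Theory.

Local Open Scope ring_scope.

Record sgraph := SGraph {
  vertex :> finType;
  adj : rel vertex;
  adj_sym : symmetric adj;
  adj_irrefl : irreflexive adj
}.

Definition isomorphic (G H : sgraph) : Prop :=
  exists f : G -> H, bijective f /\ forall x y, adj (f x) (f y) = adj x y.

Section DeleteVertex.
Variables (G : sgraph) (v : G).

Definition delete_adj : rel {u : G | u != v} :=
  fun x y => adj (val x) (val y).

Lemma delete_adj_sym : symmetric delete_adj.
Proof. by move=> x y; apply: adj_sym. Qed.

Lemma delete_adj_irrefl : irreflexive delete_adj.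
Proof. by move=> x; apply: adj_irrefl. Qed.

Definition delete_vertex : sgraph := SGraph delete_adj_sym delete_adj_irrefl.

End DeleteVertex.

Section Complete.
Variable m : nat.

Definition complete_adj : rel 'I_m := fun i j => i != j.

Lemma complete_adj_sym : symmetric complete_adj.
Proof. by move=> i j; rewrite /complete_adj eq_sym. Qed.

Lemma complete_adj_irrefl : irreflexive complete_adj.
Proof. by move=> i; rewrite /complete_adj eqxx. Qed.

Definition complete : sgraph := SGraph complete_adj_sym complete_adj_irrefl.

End Complete.

Section DisjointUnion.
Variables G H : sgraph.

Definition disjoint_union_adj : rel (G + H)%type := fun x y =>
  match x, y with
  | inl a, inl b => adj a b
  | inr a, inr b => adj a b
  | _, _ => false
  end.

Lemma disjoint_union_adj_sym : symmetric disjoint_union_adj.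
Proof. by move=> [a|a] [b|b] //=; apply: adj_sym. Qed.

Lemma disjoint_union_adj_irrefl : irreflexive disjoint_union_adj.
Proof. by move=> [a|a] /=; apply: adj_irrefl. Qed.

Definition disjoint_union : sgraph :=
  SGraph disjoint_union_adj_sym disjoint_union_adj_irrefl.

End DisjointUnion.

Section Energy.
Variable R : rcfType.

(* The vertices are numbered v_1, ..., v_n by their enumeration. *)
Definition adjacency_matrix (G : sgraph) : 'M[R]_#|G| :=
  \matrix_(i, j) (adj (enum_val i) (enum_val j))%:R.

(* rootsR lists the distinct roots in R of the characteristic polynomial; each
   is counted with its algebraic multiplicity. The adjacency matrix is symmetric,
   so all of its eigenvalues lie in the real closed field R. *)
Definition energy (G : sgraph) : R :=
  let p := char_poly (adjacency_matrix G) in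
  \sum_(x <- rootsR p) `|x| *+ mup x p.

Lemma energyE (G : sgraph) (s : seq R) :
  char_poly (adjacency_matrix G) = \prod_(x <- s) ('X - x%:P) ->
  energy G = \sum_(x <- s) `|x|.
Proof.
rewrite /energy => ->; set p := \prod_(x <- s) _.
have p0 : p != 0 by rewrite monic_neq0 // monic_prod_XsubC.
have mem x : (x \in rootsR p) = (x \in s).
  by have := roots_on_rootsR p0 x; rewrite root_prod_XsubC in_itv /= => <-.
under eq_bigr do rewrite /p mu_prod_XsubC.
have -> : \sum_(x <- rootsR p) `|x| *+ (count_mem x) s = \sum_(x <- undup s) `|x| *+ (count_mem x) s.
  apply: perm_big; apply: uniq_perm; rewrite ?undup_uniq ?uniq_roots // => x.
  by rewrite mem mem_undup.
by rewrite big_undup_iterop_count; apply: eq_bigr.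
Qed.

Definition local_energy_at (G : sgraph) (v : G) : R :=
  energy G - energy (delete_vertex v).

Definition local_energy (G : sgraph) : R :=
  \sum_(v : G) local_energy_at v.

Definition locally_equienergetic (G H : sgraph) : Prop :=
  [/\ #|G| = #|H|, ~ isomorphic G H & local_energy G = local_energy H].

End Energy.

(* Main.v *)
Require Import Defs.
From mathcomp Require Import all_boot all_order all_algebra.
From mathcomp Require Import perm ring lra.
From mathcomp Require polyrcf.

(** Energy and local energy are isomorphism invariants
    ([isomorphic_local_energy]), and every graph of order four is isomorphic to
    one of eleven ([graphs_order4]), so the statement reduces to
    comparing eleven real numbers.

    The spectrum of a graph of order at most four is governed by a few subgraph
    counts: its characteristic polynomial has coefficients given by the numbers
    of edges, triangles, perfect matchings and quadrilaterals ([char_poly3],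
    [char_poly4]).  In order three the number of edges alone determines the
    graph, hence the energy: 0, 2, 2 sqrt 2, 4 for 0, 1, 2, 3 edges.  The local
    energy of a graph of order four is thus four times its energy minus four
    terms of that table, one for each deleted vertex ([local_energy_order4]).

    The values, in increasing order, are

    - 4 K_1: 0;  K_2 + 2 K_1: 4;  P_3 + K_1: 6 sqrt 2 - 4, about 4.485;
    - C_4: 16 - 8 sqrt 2, about 4.686;
    - K_{1,3}: 8 sqrt 3 - 6 sqrt 2, about 5.371;  K_3 + K_1: 6;
    - K_4 minus an edge: 4 sqrt 17 - 4 sqrt 2 - 4, about 6.836;
    - 2 K_2 and K_4: 8;
    - the paw (a triangle with a pendant edge): 2 - 8 c - 4 sqrt 2, about 8.193,
      where c is the negative root of X^3 - X^2 - 3 X + 1;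
    - P_4: 8 sqrt 5 - 4 sqrt 2 - 4, about 8.232.

    With K_4 left out they increase strictly ([local_energy_increasing]), so
    the only coincidence is the one between K_4 and 2 K_2.  Rational bounds on
    the four square roots and on c separate the consecutive values. *)

Set Implicit Arguments.
Unset Strict Implicit.
Unset Printing Implicit Defensive.

Import Order.TTheory GRing.Theory Num.Theory.

Local Open Scope ring_scope.

(** * Invariance under isomorphism *)

Lemma isomorphic_sym (G H : sgraph) : isomorphic G H -> isomorphic H G.
Proof.
move=> [f [[g fK gK] fE]]; exists g; split; first by exists f.
by move=> x y; rewrite -fE !gK.
Qed.

Lemma isomorphic_trans (G H K : sgraph) :
  isomorphic G H -> isomorphic H K -> isomorphic G K.
Proof.
move=> [f [f_bij fE]] [g [g_bij gE]]; exists (g \o f); split.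
  exact: bij_comp.
by move=> x y; rewrite /= gE.
Qed.

(** Any numbering of the vertices computes the characteristic polynomial, since
    two numberings differ by a permutation applied to rows and columns alike,
    whose two signs cancel in the determinant.  This allows explicit numberings
    in place of the one given by [enum_val]. *)
Lemma char_poly_numbering (R : rcfType) (G : sgraph) n (f : 'I_n -> G) :
  bijective f ->
  char_poly (\matrix_(i, j) (adj (f i) (f j))%:R) =
  char_poly (adjacency_matrix R G).
Proof.
move=> f_bij; have n_eq := bij_eq_card f_bij; rewrite card_ord in n_eq.
subst n.
have inj : injective (enum_rank \o f).
  exact: inj_comp enum_rank_inj (bij_inj f_bij).
pose s := perm inj.
rewrite /char_poly; set M := char_poly_mx (adjacency_matrix R G).
rewrite (_ : char_poly_mx _ = row_perm s (col_perm s M)).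
  by rewrite row_permE col_permE !det_mulmx !det_perm odd_permV mulrCA
             -signr_addb addbb mulr1.
apply/matrixP => i j.
by rewrite !mxE !permE /= !enum_rankK (inj_eq inj).
Qed.

Lemma energy_numbering (R : rcfType) (G : sgraph) n (f : 'I_n -> G)
    (e : rel nat) (s : seq R) :
  bijective f -> (forall i j, adj (f i) (f j) = e i j) ->
  char_poly (\matrix_(i < n, j < n) (e i j)%:R) = \prod_(x <- s) ('X - x%:P) ->
  energy R G = \sum_(x <- s) `|x|.
Proof.
move=> f_bij fE pE; apply: energyE; rewrite -(char_poly_numbering R f_bij) -pE.
by congr char_poly; apply/matrixP => i j; rewrite !mxE fE.
Qed.

Lemma isomorphic_energy (R : rcfType) (G H : sgraph) :
  isomorphic G H -> energy R G = energy R H.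
Proof.
move=> [f [f_bij fE]]; rewrite /energy.
suff -> : char_poly (adjacency_matrix R G) = char_poly (adjacency_matrix R H) by [].
rewrite -(char_poly_numbering R (bij_comp f_bij (enum_val_bij _))).
by congr char_poly; apply/matrixP => i j; rewrite !mxE /= fE.
Qed.

Lemma isomorphic_delete_vertex (G H : sgraph) (f : G -> H) (v : G) :
  bijective f -> (forall x y, adj (f x) (f y) = adj x y) ->
  isomorphic (delete_vertex v) (delete_vertex (f v)).
Proof.
move=> f_bij fE; have f_inj := bij_inj f_bij.
have f_neq (x : delete_vertex v) : f (val x) != f v.
  by rewrite (inj_eq f_inj); apply: valP x.
pose g (x : delete_vertex v) : delete_vertex (f v) := exist _ (f (val x)) (f_neq x).
exists g; split; last by move=> x y; apply: fE.
apply: inj_card_bij => [x y /(congr1 val) /f_inj /val_inj //|].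
by rewrite !card_sig !cardC1 (bij_eq_card f_bij).
Qed.

Lemma isomorphic_local_energy (R : rcfType) (G H : sgraph) :
  isomorphic G H -> local_energy R G = local_energy R H.
Proof.
move=> isoGH; have eGH := isomorphic_energy R isoGH.
case: isoGH => f [f_bij fE]; rewrite /local_energy (reindex f) /=; last exact: onW_bij.
apply: eq_bigr => v _; rewrite /local_energy_at eGH.
by congr (_ - _); apply: isomorphic_energy; apply: isomorphic_delete_vertex.
Qed.

(** * Characteristic polynomials in orders three and four *)

Definition edges3 (e : rel nat) i j k : nat := (e i j + e i k + e j k)%N.

(** The entries are indexed by natural numbers because minors then stay in the
    same form, with [bump] as the reindexing of columns, and the Laplace
    expansion [det_natS] can be iterated by rewriting. *)
Definition det_nat (R : comNzRingType) n (F : nat -> nat -> R) : R :=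
  \det (\matrix_(i < n, j < n) F i j).

Lemma det_nat0 (R : comNzRingType) (F : nat -> nat -> R) : det_nat 0 F = 1.
Proof. exact: det_mx00. Qed.

Lemma det_natS (R : comNzRingType) n (F : nat -> nat -> R) :
  det_nat n.+1 F =
  \sum_(j < n.+1) (-1) ^+ j * F 0%N j *
    det_nat n (fun i k => F i.+1 (bump j k)).
Proof.
rewrite /det_nat (expand_det_row _ ord0); apply: eq_bigr => j _.
rewrite mxE /cofactor add0n mulrCA mulrA; congr (_ * \det _).
by apply/matrixP => i k; rewrite !mxE.
Qed.

Lemma char_poly_nat (R : comNzRingType) n (F : nat -> nat -> R) :
  char_poly (\matrix_(i < n, j < n) F i j) =
  det_nat n (fun i j => 'X *+ (i == j) - (F i j)%:P).
Proof. by congr (\det _); apply/matrixP => i j; rewrite !mxE. Qed.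

(** The two cyclic permutations of the indices contribute equally, whence the
    factor 2 of the triangle term; they stand for its two orientations. *)
Lemma char_poly3 (R : comNzRingType) (e : rel nat) :
  symmetric e -> irreflexive e ->
  char_poly (\matrix_(i < 3, j < 3) (e i j)%:R : 'M[R]_3) =
  'X^3 - (edges3 e 0 1 2)%N%:R * 'X - (e 0 1 * e 0 2 * e 1 2)%N%:R *+ 2.
Proof.
move=> eC e0; rewrite (char_poly_nat _ (fun i j => (e i j)%:R)).
do ![rewrite det_natS !big_ord_recl big_ord0 /=].
rewrite !det_nat0 /bump /= ?(addn0, add1n) /= !e0 /=.
rewrite (eC 1%N 0%N) (eC 2%N 0%N) (eC 2%N 1%N) /edges3.
(* The entries are 0 or 1, so their squares reduce to the entries. *)
have sq (b : bool) : (b%:R : {poly R}) ^+ 2 = b%:R.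
  by case: b; rewrite ?expr1n ?expr0n.
ring: (sq (e 0%N 1%N)) (sq (e 0%N 2%N)) (sq (e 1%N 2%N)).
Qed.

Definition edges4 (e : rel nat) : nat :=
  (e 0 1 + e 0 2 + e 0 3 + e 1 2 + e 1 3 + e 2 3)%N.

Definition triangles4 (e : rel nat) : nat :=
  (e 0 1 * e 0 2 * e 1 2 + e 0 1 * e 0 3 * e 1 3
   + e 0 2 * e 0 3 * e 2 3 + e 1 2 * e 1 3 * e 2 3)%N.

Definition matchings4 (e : rel nat) : nat :=
  (e 0 1 * e 2 3 + e 0 2 * e 1 3 + e 0 3 * e 1 2)%N.

Definition squares4 (e : rel nat) : nat :=
  (e 0 1 * e 0 2 * e 1 3 * e 2 3 + e 0 1 * e 0 3 * e 1 2 * e 2 3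
   + e 0 2 * e 0 3 * e 1 2 * e 1 3)%N.

(** Up to sign, the coefficient in degree [4 - k] is the sum of the principal
    minors of size [k].  Permutations without fixed points are products of
    disjoint cycles: transpositions give edges and perfect matchings, while each
    triangle or quadrilateral is counted twice, once for each orientation. *)
Lemma char_poly4 (R : comNzRingType) (e : rel nat) :
  symmetric e -> irreflexive e ->
  char_poly (\matrix_(i < 4, j < 4) (e i j)%:R : 'M[R]_4) =
  'X^4 - (edges4 e)%:R * 'X^2 - (triangles4 e)%:R *+ 2 * 'X
  + ((matchings4 e)%:R - (squares4 e)%:R *+ 2).
Proof.
move=> eC e0; rewrite (char_poly_nat _ (fun i j => (e i j)%:R)).
do ![rewrite det_natS !big_ord_recl big_ord0 /=].
rewrite !det_nat0 /bump /= ?(addn0, add1n) /= !e0 /=.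
rewrite (eC 1%N 0%N) (eC 2%N 0%N) (eC 3%N 0%N) (eC 2%N 1%N) (eC 3%N 1%N)
        (eC 3%N 2%N) /edges4 /triangles4 /matchings4 /squares4.
(* The entries are 0 or 1, so their squares reduce to the entries. *)
have sq (b : bool) : (b%:R : {poly R}) ^+ 2 = b%:R.
  by case: b; rewrite ?expr1n ?expr0n.
ring: (sq (e 0%N 1%N)) (sq (e 0%N 2%N)) (sq (e 0%N 3%N)) (sq (e 1%N 2%N))
      (sq (e 1%N 3%N)) (sq (e 2%N 3%N)).
Qed.

(** * Local energy of a graph given by an edge list *)

(** The relation lives on all of [nat], symmetrized and without loops, so that
    every list gives a graph and concrete adjacencies are decided by
    computation. *)
Definition edge_adj (s : seq (nat * nat)) : rel nat :=
  fun i j => (i != j) && (((i, j) \in s) || ((j, i) \in s)).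

Lemma edge_adj_sym s : symmetric (edge_adj s).
Proof. by move=> i j; rewrite /edge_adj eq_sym orbC. Qed.

Lemma edge_adj_irrefl s : irreflexive (edge_adj s).
Proof. by move=> i; rewrite /edge_adj eqxx. Qed.

Definition edge_graph n s : sgraph :=
  @SGraph 'I_n (relpre val (edge_adj s))
    (fun i j => edge_adj_sym s i j) (fun i => edge_adj_irrefl s i).

Definition energy_of_size3 (R : rcfType) (m : nat) : R :=
  nth 0 [:: 0; 2; Num.sqrt 2 *+ 2; 4] m.

Lemma sqr_sqrt_polyC (R : rcfType) n :
  (Num.sqrt n%:R)%:P ^+ 2 = n%:R :> {poly R}.
Proof. by rewrite -rmorphXn /= sqr_sqrtr ?ler0n // rmorph_nat. Qed.

(** A graph on three vertices is determined by its number [m] of edges, because it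
    has a triangle exactly when [m] is 3; the four spectra are then explicit. *)
Lemma energy_order3 (R : rcfType) (G : sgraph) (f : 'I_3 -> G) (e : rel nat) :
  bijective f -> symmetric e -> irreflexive e ->
  (forall i j, adj (f i) (f j) = e i j) ->
  energy R G = energy_of_size3 R (edges3 e 0 1 2).
Proof.
move=> f_bij eC e0 fE; set m := edges3 e 0 1 2.
suff [s pE ->] : exists2 s : seq R,
    'X^3 - m%:R * 'X - (m == 3)%:R *+ 2 = \prod_(x <- s) ('X - x%:P) &
    energy_of_size3 R m = \sum_(x <- s) `|x|.
  apply: (energy_numbering f_bij fE); rewrite char_poly3 // -/m -pE.
  by congr (_ - _%:R *+ 2); rewrite /m /edges3; do 3!case: (e _ _).
have : (m <= 3)%N by rewrite /m /edges3; do 3!case: (e _ _).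
case: m => [|[|[|[|//]]]] _; rewrite /energy_of_size3 /=.
- exists [:: 0; 0; 0]; rewrite !big_cons !big_nil ?normr0; ring.
- exists [:: 1; -1; 0]; rewrite !big_cons !big_nil ?normr0 ?normrN ?normr1; ring.
- set r := Num.sqrt 2.
  have rr : r%:P ^+ 2 = 2 :> {poly R} by exact: sqr_sqrt_polyC.
  exists [:: r; - r; 0]; rewrite !big_cons !big_nil.
    by ring: rr.
  rewrite normrN normr0 ger0_norm ?sqrtr_ge0 //; ring.
exists [:: 2; -1; -1]; rewrite !big_cons !big_nil ?normrN ?normr1 ?ger0_norm ?ler0n //; ring.
Qed.

(** The map [lift v] numbers the vertices other than [v] by ['I_3]; its
    underlying function on natural numbers is [bump v]. *)
Lemma energy_delete_vertex (R : rcfType) s (v : 'I_4) :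
  energy R (@delete_vertex (edge_graph 4 s) v) =
  energy_of_size3 R (edges3 (edge_adj s) (bump v 0) (bump v 1) (bump v 2)).
Proof.
have lift_neq i : lift v i != v :> edge_graph 4 s by rewrite eq_sym neq_lift.
pose f (i : 'I_3) : delete_vertex (v : edge_graph 4 s) :=
  exist _ (lift v i) (lift_neq i).
pose e : rel nat := fun i j => edge_adj s (bump v i) (bump v j).
apply: (@energy_order3 _ _ f e) => //.
- apply: inj_card_bij => [i j [/eqP]|]; last by rewrite card_sig cardC1 !card_ord.
  by rewrite -[_ == _]/(lift v i == lift v j) (inj_eq lift_inj) => /eqP.
- by move=> i j; apply: edge_adj_sym.
- by move=> i; apply: edge_adj_irrefl.
Qed.

(** The counts are parameters, so that on a concrete edge list the first two
    hypotheses hold by computation and the only algebra left is the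
    factorization of an explicit quartic. *)
Lemma local_energy_order4 (R : rcfType) s (m t p q m0 m1 m2 m3 : nat) (rs : seq R) :
  let e := edge_adj s in
  [:: edges4 e; triangles4 e; matchings4 e; squares4 e] = [:: m; t; p; q] ->
  [:: edges3 e 1 2 3; edges3 e 0 2 3; edges3 e 0 1 3; edges3 e 0 1 2]
    = [:: m0; m1; m2; m3] ->
  'X^4 - m%:R * 'X^2 - t%:R *+ 2 * 'X + (p%:R - q%:R *+ 2) =
    \prod_(x <- rs) ('X - x%:P) ->
  local_energy R (edge_graph 4 s) =
  (\sum_(x <- rs) `|x|) *+ 4
    - \sum_(k <- [:: m0; m1; m2; m3]) energy_of_size3 R k.
Proof.
move=> e; rewrite /e => -[<- <- <- <-] <- pE.
have -> : \sum_(x <- rs) `|x| = energy R (edge_graph 4 s).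
  symmetry; apply: (@energy_numbering _ (edge_graph 4 s) 4 id (edge_adj s)) => //.
    by exists id.
  by rewrite char_poly4 ?pE //; [apply: edge_adj_sym|apply: edge_adj_irrefl].
rewrite /local_energy /local_energy_at big_split /= sumr_const card_ord sumrN.
congr (_ - _).
rewrite (eq_bigr _ (fun v _ => energy_delete_vertex R s v)).
by rewrite !big_ord_recl big_ord0 !big_cons big_nil.
Qed.

(** * The eleven graphs of order four *)

Definition pairs4 : seq (nat * nat) :=
  [:: (0, 1); (0, 2); (0, 3); (1, 2); (1, 3); (2, 3)]%N.

Definition edges_2K2 : seq (nat * nat) := [:: (0, 1); (2, 3)]%N.

(** Listed by increasing local energy: 4 K_1, K_2 + 2 K_1, P_3 + K_1, C_4,
    K_{1,3}, K_3 + K_1, K_4 minus an edge, 2 K_2, the paw, P_4. *)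
Definition edges_not_K4 : seq (seq (nat * nat)) :=
  [:: [::];
      [:: (0, 1)];
      [:: (0, 1); (1, 2)];
      [:: (0, 1); (1, 2); (2, 3); (0, 3)];
      [:: (0, 1); (0, 2); (0, 3)];
      [:: (0, 1); (0, 2); (1, 2)];
      [:: (0, 1); (0, 2); (0, 3); (1, 2); (1, 3)];
      edges_2K2;
      [:: (0, 1); (0, 2); (1, 2); (0, 3)];
      [:: (0, 1); (1, 2); (2, 3)]]%N.

Lemma isomorphic_edge_graph4 (G : sgraph) : #|G| = 4%N ->
  exists2 m, size m = 6%N & isomorphic (edge_graph 4 (mask m pairs4)) G.
Proof.
move=> G4; pose f (i : 'I_4) : G := enum_val (cast_ord (esym G4) i).
pose a i j := adj (f (inord i)) (f (inord j)).
exists [seq a e.1 e.2 | e <- pairs4] => //.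
rewrite -(filter_mask (fun e => a e.1 e.2)); exists f; split.
  apply: (bij_comp (enum_val_bij _)).
  by exists (cast_ord G4); [apply: cast_ordKV | apply: cast_ordK].
have aE (i j : 'I_4) : adj (f i) (f j) = a i j by rewrite /a !inord_val.
have aC x y : a x y = a y x by apply: adj_sym.
have a0 x : a x x = false by apply: adj_irrefl.
move=> i j; rewrite aE -[RHS]/(edge_adj _ i j) /edge_adj.
rewrite !mem_filter /= (aC j) -andb_orr.
case: i j => [[|[|[|[|//]]]] ?] [[|[|[|[|//]]]] ?];
  by rewrite /= ?a0 ?andbT.
Qed.

Definition relabels (p : seq nat) (s t : seq (nat * nat)) : bool :=
  all (fun i => all (fun j =>
    edge_adj t (nth 0%N p i) (nth 0%N p j) == edge_adj s i j)
    (iota 0 4)) (iota 0 4).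

Lemma relabels_isomorphic p s t : p \in permutations (iota 0 4) ->
  relabels p s t -> isomorphic (edge_graph 4 s) (edge_graph 4 t).
Proof.
rewrite mem_permutations => p_perm /allP st.
have szp : size p = 4 by rewrite (perm_size p_perm).
have p_lt (i : 'I_4) : (nth 0%N p i < 4)%N.
  have : nth 0%N p i \in p by rewrite mem_nth ?szp.
  by rewrite (perm_mem p_perm) mem_iota.
exists (fun i => Ordinal (p_lt i)); split.
  apply: injF_bij => i j [] /eqP.
  rewrite nth_uniq ?szp ?(perm_uniq p_perm) ?iota_uniq //.
  by move=> /eqP /val_inj.
move=> i j; have iota4 (k : 'I_4) : val k \in iota 0 4.
  by rewrite mem_iota ltn_ord.
by have /allP /(_ _ (iota4 j)) /eqP := st _ (iota4 i).
Qed.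

(** A numbered graph of order four is one of 64 subsets of the six pairs, and for
    each of them a search through the 24 relabellings reaches one of the eleven
    representatives. *)
Lemma graphs_order4 (G : sgraph) : #|G| = 4%N ->
  exists2 s, s \in pairs4 :: edges_not_K4 & isomorphic G (edge_graph 4 s).
Proof.
move=> /isomorphic_edge_graph4[m sz_m isoG].
have : has (fun s => has (fun p => relabels p (mask m pairs4) s)
    (permutations (iota 0 4))) (pairs4 :: edges_not_K4).
  case: m sz_m {isoG} => [|a [|b [|c [|d [|e [|f []]]]]]] // _.
  by case: a; case: b; case: c; case: d; case: e; case: f; vm_compute.
case/hasP=> s s_in /hasP[p p_in /(relabels_isomorphic p_in) iso_s].
by exists s => //; apply: isomorphic_trans iso_s; apply: isomorphic_sym.
Qed.

Lemma complete4_edge_graph : isomorphic (complete 4) (edge_graph 4 pairs4).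
Proof.
exists id; split; first by exists id.
by move=> [[|[|[|[|//]]]] ?] [[|[|[|[|//]]]] ?].
Qed.

(** [split] sends the vertices 0, 1 to the left copy of K_2 and 2, 3 to the right
    one. *)
Lemma union2_edge_graph :
  isomorphic (disjoint_union (complete 2) (complete 2)) (edge_graph 4 edges_2K2).
Proof.
apply: isomorphic_sym; exists (@split 2 2); split.
  by exists (@unsplit 2 2); [apply: splitK|apply: unsplitK].
move=> /= i j; rewrite -(@splitK 2 2 i) -(@splitK 2 2 j) !unsplitK.
by case: (@split 2 2 i) => -[[|[|//]] ?]; case: (@split 2 2 j) => -[[|[|//]] ?].
Qed.

Lemma complete4_not_union2 :
  ~ isomorphic (complete 4) (disjoint_union (complete 2) (complete 2)).
Proof.
move=> [f [[g fK gK] fE]].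
have := fE (g (inl ord0)) (g (inr ord0)); rewrite !gK /= /complete_adj.
by rewrite (can_eq gK).
Qed.

(** * Local energies of the eleven graphs *)

Lemma sqrt_between (R : rcfType) (a b x : R) :
  0 <= a -> 0 <= b -> a ^+ 2 < x < b ^+ 2 -> a < Num.sqrt x < b.
Proof.
move=> a_ge0 b_ge0 /andP[ax xb].
have x_gt0 : 0 < x by apply: le_lt_trans ax; apply: sqr_ge0.
rewrite -{1}(ger0_norm a_ge0) -(ger0_norm b_ge0) -!sqrtr_sqr !ltr_sqrt ?ax //.
exact: lt_trans xb.
Qed.

(** The quartic is the product of [X + 1] and the cubic [X^3 - X^2 - 3 X + 1].
    The cubic has one negative root [c] and two positive roots [a] and [b] with
    [a + b = 1 - c], so the sum of absolute values, [1 - c + (a + b)], depends on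
    [c] alone. *)
Lemma paw_spectrum (R : rcfType) : exists2 c : R,
  - (46 / 31) < c < - (22 / 15) &
  exists2 rs : seq R,
    'X^4 - 4 * 'X^2 - 2 * 'X + 1 = \prod_(x <- rs) ('X - x%:P) &
    \sum_(x <- rs) `|x| = 2 - 2 * c.
Proof.
pose g : {poly R} := 'X^3 - 'X^2 - 3 *: 'X + 1.
have gE x : g.[x] = x ^+ 3 - x ^+ 2 - 3 * x + 1 by rewrite /g !hornerE.
have [||c] := @polyrcf.poly_ivtoo R g (- (46 / 31)) (- (22 / 15)).
- lra.
- rewrite !gE; lra.
rewrite in_itv /= => c_itv /rootP; rewrite gE => gc.
exists c => //; case/andP: c_itv => c_lo c_hi.
(* Dividing the cubic by X - c leaves X^2 + (c - 1) X + (c^2 - c - 3), of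
   discriminant D. *)
set D := 13 + 2 * c - 3 * c ^+ 2; set r := Num.sqrt D.
have D_ge0 : 0 <= D by rewrite /D; nra.
have rD : r ^+ 2 = D by apply: sqr_sqrtr.
have r_ge0 : 0 <= r by apply: sqrtr_ge0.
(* Both roots are positive because their product c^2 - c - 3 is. *)
have c_sq : (22 / 15) ^+ 2 < c ^+ 2 by nra.
have D_lt : D < (1 - c) ^+ 2 by rewrite /D; nra.
have r_lt : r < 1 - c.
  by rewrite -(ltr_pXn2r (n := 2)) ?nnegrE ?rD //; lra.
pose a := (1 - c + r) / 2; pose b := (1 - c - r) / 2.
have sumab : a + b = 1 - c by rewrite /a /b; field.
have prodab : a * b = c ^+ 2 - c - 3.
  transitivity (((1 - c) ^+ 2 - r ^+ 2) / 4); first by rewrite /a /b; field.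
  by rewrite rD /D; field.
exists [:: a; b; c; -1].
  rewrite !big_cons big_nil.
  transitivity (('X^2 - (a + b)%:P * 'X + (a * b)%:P)
                * (('X - c%:P) * ('X + 1))); last ring.
  rewrite sumab prodab.
  have gC : c%:P ^+ 3 = c%:P ^+ 2 + 3 * c%:P - 1 :> {poly R}.
    rewrite -rmorphXn /=; have -> : c ^+ 3 = c ^+ 2 + 3 * c - 1 by lra.
    ring.
  ring: gC.
rewrite !big_cons big_nil normrN normr1 (ltr0_norm (x := c)); last lra.
rewrite !ger0_norm; first (rewrite addrA sumab; ring).
  by rewrite /b; lra.
by rewrite /a; lra.
Qed.

Lemma local_energy_values (R : rcfType) : exists2 c : R,
  - (46 / 31) < c < - (22 / 15) &
  [seq local_energy R (edge_graph 4 s) | s <- edges_not_K4] =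
  [:: 0; 4; 6 * Num.sqrt 2 - 4; 16 - 8 * Num.sqrt 2;
      8 * Num.sqrt 3 - 6 * Num.sqrt 2; 6;
      4 * Num.sqrt 17 - 4 * Num.sqrt 2 - 4; 8;
      2 - 8 * c - 4 * Num.sqrt 2; 8 * Num.sqrt 5 - 4 * Num.sqrt 2 - 4].
Proof.
have [c c_itv [paw pawE paw_sum]] := paw_spectrum R.
exists c => //.
have norm_nat n : `|n%:R| = n%:R :> R by rewrite normr_nat.
have w2 := sqr_sqrt_polyC R 2; have w3 := sqr_sqrt_polyC R 3.
have n2 : `|Num.sqrt 2| = Num.sqrt 2 :> R by rewrite ger0_norm ?sqrtr_ge0.
have n3 : `|Num.sqrt 3| = Num.sqrt 3 :> R by rewrite ger0_norm ?sqrtr_ge0.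
have /andP[lo17 hi17] : 4 < Num.sqrt (17 : R) < 5 by clear; apply: sqrt_between; lra.
have /andP[lo5 hi5] : 2 < Num.sqrt (5 : R) < 3 by clear; apply: sqrt_between; lra.
(* The positive roots of X^2 - X - 4, a factor for K_4 minus an edge, and of
   X^2 - X - 1, a factor for P_4. *)
pose h17 : R := (1 + Num.sqrt 17) / 2; pose h5 : R := (1 + Num.sqrt 5) / 2.
have h17E : h17%:P ^+ 2 = h17%:P + 4 :> {poly R}.
  rewrite -rmorphXn /=; have -> : h17 ^+ 2 = h17 + 4; last ring.
  have : Num.sqrt 17 ^+ 2 = 17 :> R by rewrite sqr_sqrtr.
  by rewrite /h17; lra.
have h5E : h5%:P ^+ 2 = h5%:P + 1 :> {poly R}.
  rewrite -rmorphXn /=; have -> : h5 ^+ 2 = h5 + 1; last ring.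
  have : Num.sqrt 5 ^+ 2 = 5 :> R by rewrite sqr_sqrtr.
  by rewrite /h5; lra.
rewrite /edges_not_K4 /=; congr [:: _; _; _; _; _; _; _; _; _; _].
- rewrite (@local_energy_order4 _ _ 0 0 0 0 0 0 0 0 [:: 0; 0; 0; 0]) //.
    rewrite !big_cons !big_nil normr0 /energy_of_size3 /=; ring.
  rewrite !big_cons big_nil; ring.
- rewrite (@local_energy_order4 _ _ 1 0 0 0 0 0 1 1 [:: 1; -1; 0; 0]) //.
    rewrite !big_cons !big_nil normr0 normrN normr1 /energy_of_size3 /=; ring.
  rewrite !big_cons big_nil; ring.
- rewrite (@local_energy_order4 _ _ 2 0 0 0 1 0 1 2
      [:: Num.sqrt 2; - Num.sqrt 2; 0; 0]) //.
    rewrite !big_cons !big_nil normr0 normrN n2 /energy_of_size3 /=; ring.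
  rewrite !big_cons big_nil; ring: w2.
- rewrite (@local_energy_order4 _ _ 4 0 2 1 2 2 2 2 [:: 2; -2; 0; 0]) //.
    rewrite !big_cons !big_nil normr0 normrN norm_nat /energy_of_size3 /=; ring.
  rewrite !big_cons big_nil; ring.
- rewrite (@local_energy_order4 _ _ 3 0 0 0 0 2 2 2
      [:: Num.sqrt 3; - Num.sqrt 3; 0; 0]) //.
    rewrite !big_cons !big_nil normr0 normrN n3 /energy_of_size3 /=; ring.
  rewrite !big_cons big_nil; ring: w3.
- rewrite (@local_energy_order4 _ _ 3 1 0 0 1 1 1 3 [:: 2; -1; -1; 0]) //.
    rewrite !big_cons !big_nil normr0 normrN normr1 norm_nat /energy_of_size3 /=; ring.
  rewrite !big_cons big_nil; ring.
- rewrite (@local_energy_order4 _ _ 5 2 2 1 2 2 3 3 [:: h17; 1 - h17; -1; 0]) //.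
    rewrite !big_cons !big_nil normr0 normrN normr1 /energy_of_size3 /=.
    rewrite (ger0_norm (x := h17)) 1?(ltr0_norm (x := 1 - h17)); [|rewrite /h17; lra..].
    by rewrite /h17; lra.
  rewrite !big_cons big_nil; ring: h17E.
- rewrite (@local_energy_order4 _ _ 2 0 1 0 1 1 1 1 [:: 1; 1; -1; -1]) //.
    rewrite !big_cons !big_nil normrN normr1 /energy_of_size3 /=; ring.
  rewrite !big_cons big_nil; ring.
- rewrite (@local_energy_order4 _ _ 4 1 1 0 1 2 2 3 paw) //.
    rewrite paw_sum !big_cons !big_nil /energy_of_size3 /=; ring.
  rewrite -pawE; ring.
- rewrite (@local_energy_order4 _ _ 3 0 1 0 2 1 1 2 [:: h5; 1 - h5; - h5; h5 - 1]) //.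
    rewrite !big_cons !big_nil normrN (distrC 1) /energy_of_size3 /=.
    rewrite (ger0_norm (x := h5)) 1?(ger0_norm (x := h5 - 1)); [|rewrite /h5; lra..].
    by rewrite /h5; lra.
  rewrite !big_cons big_nil; ring: h5E.
Qed.

Lemma local_energy_K4 (R : rcfType) : local_energy R (edge_graph 4 pairs4) = 8.
Proof.
rewrite (@local_energy_order4 _ _ 6 4 3 3 3 3 3 3 [:: 3; -1; -1; -1]) //.
  rewrite !big_cons !big_nil normrN normr1 normr_nat /energy_of_size3 /=; ring.
rewrite !big_cons big_nil; ring.
Qed.

Lemma in_inj_of_uniq_map (T1 T2 : eqType) (f : T1 -> T2) (s : seq T1) :
  uniq (map f s) -> {in s &, injective f}.
Proof.
elim: s => //= x s IHs /andP[fx_notin /IHs inj_s] y z.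
rewrite !inE => /predU1P[->|ys] /predU1P[->|zs] // eq_f; last exact: inj_s.
  by rewrite eq_f map_f in fx_notin.
by rewrite -eq_f map_f in fx_notin.
Qed.

(** Each comparison of consecutive values is linear in [c] and the square roots,
    so it follows from rational enclosures.  The tightest gap, about 0.04,
    separates the paw from P_4; it dictates the lower bounds on [c] and on
    [sqrt 5]. *)
Lemma local_energy_increasing (R : rcfType) :
  sorted <%R [seq local_energy R (edge_graph 4 s) | s <- edges_not_K4].
Proof.
have [c c_itv ->] := local_energy_values R.
have w2_itv : 7 / 5 < Num.sqrt (2 : R) < 17 / 12.
  by clear; apply: sqrt_between; lra.
have w3_itv : 19 / 11 < Num.sqrt (3 : R) < 7 / 4.
  by clear; apply: sqrt_between; lra.
have w17_itv : 4 < Num.sqrt (17 : R) < 21 / 5.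
  by clear; apply: sqrt_between; lra.
have w5_itv : 38 / 17 < Num.sqrt (5 : R) < 3.
  by clear; apply: sqrt_between; lra.
move: (Num.sqrt 2) (Num.sqrt 3) (Num.sqrt 17) (Num.sqrt 5)
  w2_itv w3_itv w17_itv w5_itv.
move: c_itv => /andP[c_lo c_hi] w2 w3 w17 w5.
move=> /andP[lo2 hi2] /andP[lo3 hi3] /andP[lo17 hi17] /andP[lo5 hi5].
rewrite /=; apply/and5P; split; last (apply/and5P; split => //).
1-9: clear - c_lo c_hi lo2 hi2 lo3 hi3 lo17 hi17 lo5; lra.
Qed.

Lemma local_energy_inj (R : rcfType) :
  {in edges_not_K4 &, injective (fun s => local_energy R (edge_graph 4 s))}.
Proof.
exact: in_inj_of_uniq_map (lt_sorted_uniq (local_energy_increasing R)).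
Qed.

Lemma local_energy_2K2 (R : rcfType) :
  local_energy R (edge_graph 4 edges_2K2) = 8.
Proof.
by have [c _ /(congr1 (nth 0 ^~ 7))] := local_energy_values R.
Qed.

Local Close Scope ring_scope.

Theorem proposition3 (R : rcfType) :
  locally_equienergetic R (complete 4)
    (disjoint_union (complete 2) (complete 2)) /\
  (forall G H : sgraph,
     #|G| = 4 -> #|H| = 4 -> locally_equienergetic R G H ->
     (isomorphic G (complete 4) /\
      isomorphic H (disjoint_union (complete 2) (complete 2))) \/
     (isomorphic G (disjoint_union (complete 2) (complete 2)) /\
      isomorphic H (complete 4))).
Proof.
have toK4 := isomorphic_sym complete4_edge_graph.
have to2K2 := isomorphic_sym union2_edge_graph.
have eq8 := etrans (local_energy_K4 R) (esym (local_energy_2K2 R)).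
split.
  split; [by rewrite card_sum !card_ord | exact: complete4_not_union2 |].
  exact: etrans (isomorphic_local_energy R complete4_edge_graph)
    (etrans eq8 (isomorphic_local_energy R to2K2)).
have in2K2 : edges_2K2 \in edges_not_K4 by [].
move=> G H /graphs_order4[s s_in isoG] /graphs_order4[t t_in isoH] [_ nisoGH].
rewrite (isomorphic_local_energy R isoG) (isomorphic_local_energy R isoH) => eq_e.
have neq_st : s <> t.
  move=> eq_st; case: nisoGH; apply: isomorphic_trans isoG _.
  by rewrite eq_st; apply: isomorphic_sym.
move: s_in t_in; rewrite !in_cons => /orP[/eqP sK4 | s_in] /orP[/eqP tK4 | t_in].
- by case: neq_st; rewrite sK4 tK4.
- left; rewrite sK4 in eq_e isoG.
  have tE := local_energy_inj t_in in2K2 (etrans (esym eq_e) eq8).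
  rewrite tE in isoH; split; first exact: isomorphic_trans isoG toK4.
  exact: isomorphic_trans isoH to2K2.
- right; rewrite tK4 in eq_e isoH.
  have sE := local_energy_inj s_in in2K2 (etrans eq_e eq8).
  rewrite sE in isoG; split; first exact: isomorphic_trans isoG to2K2.
  exact: isomorphic_trans isoH toK4.
- by case: neq_st; apply: local_energy_inj eq_e.
Qed.
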